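(* Let $a,b\ge1$ be integers, $J=(x^a,y^b)$, let $I\in\mathcal I_{a,b}$, and let $I_0$ be the quasi-equigenerated part of $I$. Then for every integer $k\ge1$, $$G(I_0^k)\setminus G(JI_0^{k-1})\subseteq G(I^k)\setminus G(JI^{k-1}).$$ In particular, $r(I_0)\le r(I)$.
   Context: $K$ is a field. For a monomial ideal $I\subset K[x,y]$, $G(I)$ is its unique minimal set of monomial generators. For a monomial $u=x^cy^d$ put $\nu(u)=(bc+ad)/(ab)$. $\mathcal I_{a,b}$ is the set of monomial ideals $I\subset K[x,y]$ with $x^a,y^b\in G(I)$ and $\nu(u)\ge1$ for all $u\in G(I)$. The quasi-equigenerated part $I_0$ of $I\in\mathcal I_{a,b}$ is the monomial ideal generated by all $u\in G(I)$ with $\nu(u)=1$; it again belongs to $\mathcal I_{a,b}$. For $L\in\mathcal I_{a,b}$, the reduction number $r(L)$ is the smallest integer $r\ge0$ with $L^{r+1}=JL^r$ (such $r$ exists). By convention $L^0=K[x,y]$. *)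

(* Defs.v *)
From HB Require Import structures.
From mathcomp Require Import all_boot all_order all_algebra.
From mathcomp Require Import boolp classical_sets.
From mathcomp Require Export mpoly.

Set Implicit Arguments.
Unset Strict Implicit.
Unset Printing Implicit Defensive.

Import Order.TTheory GRing.Theory Num.Theory.
Local Open Scope classical_set_scope.
Local Open Scope ring_scope.

(* K[x, y] is {mpoly K[2]} with x = 'X_0 and y = 'X_1; the monomial x^c y^d is
   represented by its exponent vector m : 'X_{1..2}, m 0 = c and m 1 = d. *)

Section Ideals.
Variable R : comNzRingType.
Implicit Types (S A B : set R).

(* MathComp's idealr only covers proper, boolean ideals, whereas the convention
   L^0 = K[x, y] requires the unit ideal. *)
Definition ideal_gen S : set R :=
  [set p | exists n (c g : 'I_n -> R),
     (forall i, S (g i)) /\ p = \sum_(i < n) c i * g i].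

Definition ideal_mul A B : set R :=
  ideal_gen [set p | exists f g, [/\ A f, B g & p = f * g]].

Fixpoint ideal_pow A (k : nat) : set R :=
  if k is k'.+1 then ideal_mul A (ideal_pow A k') else setT.

End Ideals.

Section MonomialIdeals.
Variable K : fieldType.
Implicit Types (I J L : set {mpoly K[2]}) (S T : set 'X_{1..2}).

Definition mono_ideal S : set {mpoly K[2]} :=
  ideal_gen [set 'X_[m] | m in S].

Definition is_mono_ideal I : Prop := exists S, I = mono_ideal S.

Definition is_min_gens I S : Prop :=
  I = mono_ideal S /\ (forall T, T `<=` S -> I = mono_ideal T -> T = S).

(* Meaningful for monomial ideals only: see mingensP and mingens_unique. *)
Definition mingens I : set 'X_{1..2} := xget set0 [set S | is_min_gens I S].

Definition xpow (a : nat) : 'X_{1..2} := (U_(0%R) *+ a)%MM.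
Definition ypow (b : nat) : 'X_{1..2} := (U_(1%R) *+ b)%MM.

Definition nu (a b : nat) (u : 'X_{1..2}) : rat :=
  (b * u 0 + a * u 1)%:R / (a * b)%:R.

Definition Jideal (a b : nat) : set {mpoly K[2]} :=
  mono_ideal [set xpow a; ypow b].

Definition in_Iab (a b : nat) I : Prop :=
  [/\ is_mono_ideal I, mingens I (xpow a), mingens I (ypow b)
    & forall u, mingens I u -> 1 <= nu a b u].

Definition qe_part (a b : nat) I : set {mpoly K[2]} :=
  mono_ideal [set u | mingens I u /\ nu a b u = 1].

Definition is_reduction_number J L (r : nat) : Prop :=
  ideal_pow L r.+1 = ideal_mul J (ideal_pow L r) /\
  (forall s, ideal_pow L s.+1 = ideal_mul J (ideal_pow L s) -> (r <= s)%N).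

(* The default value 0 is irrelevant for J = (x^a, y^b) and L in I_{a,b}: a
   generator u of L satisfies u^(ab) \in J L^(ab-1), so a reduction number
   exists because L is finitely generated. *)
Definition reduction_number J L : nat := xget 0%N [set r | is_reduction_number J L r].

Lemma mono_ideal_mem S m :
  mono_ideal S 'X_[m] <-> exists2 s, S s & (s <= m)%MM.
Proof.
split; last first.
  move=> [s Ss le_sm]; exists 1%N, (fun=> 'X_[m - s]), (fun=> 'X_[s]).
  split; first by move=> _; exists s.
  by rewrite big_ord1 -mpolyXD submK.
move=> [n [c [g [Sg eq_m]]]].
apply: contrapT => noS; move/(congr1 (mcoeff m))/eqP: eq_m.
rewrite mcoeffX eqxx raddf_sum /= big1 ?oner_eq0 // => i _.
have [s Ss <-] := Sg i.
rewrite mcoeffMr big1 // => -[m1 m2] /= /eqP eqm.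
rewrite mcoeffX; case: eqP => [eqs|_]; last by rewrite ?mul0r ?mulr0.
by case: noS; exists s => //; rewrite eqm eqs ?lem_addl ?lem_addr.
Qed.

Lemma ideal_genS (A : set {mpoly K[2]}) n (c g : 'I_n -> {mpoly K[2]}) :
  (forall i, ideal_gen A (g i)) -> ideal_gen A (\sum_(i < n) c i * g i).
Proof.
move=> Ag; apply: (big_ind (ideal_gen A)).
- by exists 0%N, (fun=> 0), (fun=> 0); split=> [[]//|]; rewrite big_ord0.
- move=> _ _ [n1 [c1 [g1 [A1 ->]]]] [n2 [c2 [g2 [A2 ->]]]].
  exists (n1 + n2)%N.
  exists (fun i => match split i with inl j => c1 j | inr j => c2 j end).
  exists (fun i => match split i with inl j => g1 j | inr j => g2 j end).
  split; first by move=> i; case: (split i).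
  rewrite big_split_ord /=; congr (_ + _); apply: eq_bigr => i _.
    by have /= -> := unsplitK (inl i : 'I_n1 + 'I_n2).
  by have /= -> := unsplitK (inr i : 'I_n1 + 'I_n2).
- move=> i _; have [k [d [h [Ah ->]]]] := Ag i.
  exists k, (fun j => c i * d j), h; split=> //.
  by rewrite mulr_sumr; apply: eq_bigr => j _; rewrite mulrA.
Qed.

Lemma mono_ideal_sub S T :
  (forall s, S s -> exists2 t, T t & (t <= s)%MM) ->
  mono_ideal S `<=` mono_ideal T.
Proof.
move=> ST _ [n [c [g [Sg ->]]]]; apply: ideal_genS => i.
by have [s Ss <-] := Sg i; apply/mono_ideal_mem/ST.
Qed.

Lemma mono_ideal_mingens S :
  is_min_gens (mono_ideal S)
    [set s | S s /\ forall t, S t -> (t <= s)%MM -> t = s].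
Proof.
set M := [set s | _].
have below s : S s -> exists2 t, M t & (t <= s)%MM.
  have [n] := ubnP (mdeg s); elim: n s => // n IHn s /ltnSE le_sn Ss.
  have [Ms|nMs] := pselect (M s); first by exists s; rewrite ?lepm_refl.
  have [t [St le_ts ne_ts]] : exists t, [/\ S t, (t <= s)%MM & t <> s].
    apply: contrapT => noT; apply: nMs; split=> // t St le_ts.
    by apply: contrapT => ne_ts; apply: noT; exists t.
  have lt_ts : (mdeg t < mdeg s)%N.
    rewrite -(submK le_ts) mdegD -[X in (X < _)%N]add0n ltn_add2r lt0n mdeg_eq0.
    by apply/eqP=> d0; apply: ne_ts; rewrite -(submK le_ts) d0 add0m.
  have [u Mu le_ut] := IHn t (leq_trans lt_ts le_sn) St.
  by exists u => //; apply: lepm_trans le_ut le_ts.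
have eqSM : mono_ideal S = mono_ideal M.
  apply/seteqP; split; apply: mono_ideal_sub => // s [Ss _].
  by exists s; rewrite ?lepm_refl.
split=> // T sTM eqT; apply/seteqP; split=> // s [Ss min_s].
have : mono_ideal S 'X_[s] by apply/mono_ideal_mem; exists s; rewrite ?lepm_refl.
rewrite eqT => /mono_ideal_mem[t Tt le_ts].
by rewrite -(min_s t) //; case: (sTM _ Tt).
Qed.

Lemma mingensP I : is_mono_ideal I -> is_min_gens I (mingens I).
Proof.
by move=> [S ->]; apply: (xgetPex set0 (P := is_min_gens _));
  eexists; apply: mono_ideal_mingens.
Qed.

Lemma mingens_unique I S : is_min_gens I S -> S = mingens I.
Proof.
move=> minS; have /mingensP[eqI minI] : is_mono_ideal I by exists S; case: minS.
have min_sub A B : is_min_gens I A -> I = mono_ideal B -> A `<=` B.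
  move=> [eqA minA] eqB.
  pose T := [set s | A s /\ exists2 t, B t & (s <= t)%MM].
  have le_mem C D s : I = mono_ideal C -> I = mono_ideal D -> C s ->
      exists2 t, D t & (t <= s)%MM.
    by move=> eqC eqD Cs; apply/mono_ideal_mem; rewrite -eqD eqC;
      apply/mono_ideal_mem; exists s; rewrite ?lepm_refl.
  have genA C s t : C = [set u | A u /\ u <> s] -> A s -> A t -> t <> s ->
      (t <= s)%MM -> False.
    move=> eqC As At ne_ts le_ts.
    suff eqs : C = A by move: As; rewrite -eqs eqC => -[].
    apply: minA; first by rewrite eqC => u [].
    rewrite eqA; apply/seteqP; split; apply: mono_ideal_sub => u.
      have [->|ne_us] := pselect (u = s); first by exists t; rewrite ?eqC.
      by exists u; rewrite ?lepm_refl ?eqC.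
    by rewrite eqC => -[Au _]; exists u; rewrite ?lepm_refl.
  move=> s As; have [t Bt le_ts] := le_mem _ _ _ eqA eqB As.
  have [u Au le_ut] := le_mem _ _ _ eqB eqA Bt.
  have eq_us : u = s.
    apply: contrapT => ne_us.
    exact: (genA _ s u erefl As Au ne_us (lepm_trans le_ut le_ts)).
  suff <- : t = s by [].
  apply/mnmP=> i; apply/eqP; rewrite eqn_leq (mnm_lepP le_ts).
  by rewrite -eq_us (mnm_lepP le_ut).
have [eqS _] := minS.
by apply/seteqP; split; apply: min_sub.
Qed.

End MonomialIdeals.

Arguments Jideal K a b : clear implicits.

(* Main.v *)
Require Import Defs.
From mathcomp Require Import all_boot all_order all_algebra.
From mathcomp Require Import boolp classical_sets.
From mathcomp Require Import zify.
Local Open Scope classical_set_scope.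

(** Everything is read off exponent vectors.  Products and powers of monomial
    ideals are generated by the sums of the exponents of generators
    ([ideal_mul_mono], [ideal_pow_mono]), and the minimal generators of a
    monomial ideal are the minimal elements of any generating set
    ([mingens_mono_ideal]).

    Multiplying [nu] by [a * b] gives the additive weight
    [wt u = b * u 0 + a * u 1]; the generators of [I] have weight at least
    [a * b], and those of [I0] are exactly the ones for which equality holds.
    Hence the [k]-fold sums of generators of [I0] are exactly the [k]-fold sums
    of generators of [I] having the least conceivable weight [k * (a * b)]
    ([wt_ksum_eq]).  Since [wt] is strictly monotone, an exponent of least
    weight is automatically minimal, so a generator [u] of [I0^k] is a minimal
    generator of [I^k].  If [u] also were a generator of [J I^(k-1)], say
    [u = j + v], then [v] would have the least weight [(k-1) * (a * b)], hence
    come from [I0^(k-1)], and [u] would be a generator of [J I0^(k-1)].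

    If [I^(r+1) = J I^r], the right-hand side of the inclusion is empty for
    [k = r+1], so every generator of [I0^(r+1)] lies in [J I0^r].  This bounds
    the reduction number of [I0] by [r], provided that [I] has a reduction
    number at all ([has_reduction]).  That rests on two facts: [I] has finitely
    many minimal generators, so a long enough product of them repeats some
    generator [u] at least [a * b] times; and [u ^ (a * b)] is divisible by a
    product of [a * b] factors [x^a] and [y^b], because
    [b * u 0 + a * u 1 >= a * b]. *)

Set Implicit Arguments.
Unset Strict Implicit.
Unset Printing Implicit Defensive.

Import Order.TTheory GRing.Theory Num.Theory.

(** * Exponent vectors: weights and multiple sums *)

Section Exponents.
Implicit Types (S T E : set 'X_{1..2}) (u v m : 'X_{1..2}).

Lemma mnm2_lepP u v : reflect (u 0%R <= v 0%R /\ u 1%R <= v 1%R)%N (u <= v)%MM.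
Proof.
apply: (iffP mnm_lepP) => [le_uv|[le0 le1] i]; first by split.
case: i => [[|[|//]] lt_i]; last first.
  by have -> : Ordinal lt_i = 1%R by apply: val_inj.
by have -> : Ordinal lt_i = 0%R by apply: val_inj.
Qed.

Lemma mnm_le_anti u v : (u <= v)%MM -> (v <= u)%MM -> u = v.
Proof.
move=> /mnm_lepP le_uv /mnm_lepP le_vu; apply/mnmP=> i.
by apply/eqP; rewrite eqn_leq le_uv le_vu.
Qed.

Lemma xpowE c : (xpow c 0%R = c) * (xpow c 1%R = 0%N).
Proof. by rewrite /xpow !mulmnE !mnm1E /= mul1n mul0n. Qed.

Lemma ypowE c : (ypow c 0%R = 0%N) * (ypow c 1%R = c).
Proof. by rewrite /ypow !mulmnE !mnm1E /= mul1n mul0n. Qed.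

Definition addset S T : set 'X_{1..2} :=
  [set m | exists s t, [/\ S s, T t & m = (s + t)%MM]].

Definition msum (s : seq 'X_{1..2}) : 'X_{1..2} := (\sum_(u <- s) u)%MM.

Definition ksum E (k : nat) : set 'X_{1..2} :=
  [set m | exists s, [/\ size s = k, forall u, u \in s -> E u & m = msum s]].

Lemma msum_cat s t : msum (s ++ t) = (msum s + msum t)%MM.
Proof. exact: big_cat. Qed.

Lemma msum_nseq n u : msum (nseq n u) = (u *+ n)%MM.
Proof.
by elim: n => [|n IHn]; rewrite /msum ?big_nil //= big_cons mulmS -IHn.
Qed.

Lemma ksum0 E : ksum E 0 = [set 0%MM].
Proof.
apply/seteqP; split=> [_ [s [/size0nil -> _ ->]]|_ ->] /=.
  exact: big_nil.
by exists [::]; split=> //; rewrite /msum big_nil.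
Qed.

Lemma ksumS E k : ksum E k.+1 = addset E (ksum E k).
Proof.
apply/seteqP; split=> m.
  move=> [[|u s] [] //= [sz] Es ->]; exists u, (msum s); split.
  - by apply: Es; rewrite mem_head.
  - by exists s; split=> // v vs; apply: Es; rewrite inE vs orbT.
  - by rewrite /msum big_cons.
move=> [u [_ [Eu [s [sz Es ->]] ->]]]; exists (u :: s); split=> /=.
- by rewrite sz.
- by move=> v; rewrite inE => /orP[/eqP->|/Es].
- by rewrite /msum big_cons.
Qed.

Section Weight.
Variables a b : nat.

Definition wt u : nat := (b * u 0%R + a * u 1%R)%N.

Lemma wtD u v : wt (u + v)%MM = (wt u + wt v)%N.
Proof. by rewrite /wt !mnmDE; lia. Qed.

Lemma wt0 : wt 0%MM = 0%N.
Proof. by rewrite /wt !mnm0E !muln0. Qed.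

Lemma wt_xpow : wt (xpow a) = (a * b)%N.
Proof. by rewrite /wt !xpowE; lia. Qed.

Lemma wt_ypow : wt (ypow b) = (a * b)%N.
Proof. by rewrite /wt !ypowE; lia. Qed.

Section LowestWeight.
Variable c : nat.
Variable E : set 'X_{1..2}.
Hypothesis wtE : forall u, E u -> (c <= wt u)%N.

Definition lowest := [set u | E u /\ wt u = c].

Lemma wt_ksum_ge k m : ksum E k m -> (k * c <= wt m)%N.
Proof.
elim: k m => [|k IHk] m; first by [].
rewrite ksumS => -[u [v [/wtE le_u /IHk le_v ->]]].
by rewrite wtD; lia.
Qed.

(** A sum of [k] weights, each at least [c], attains [k * c] only if every
    one of them equals [c]. *)
Lemma wt_ksum_eq k m : ksum lowest k m <-> ksum E k m /\ wt m = (k * c)%N.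
Proof.
elim: k m => [|k IHk] m.
  by rewrite !ksum0; split=> [->|[]//]; split=> //; rewrite wt0.
rewrite !ksumS; split.
  move=> [u [v [[Eu wu] /IHk[Ev wv] ->]]]; split; first by exists u, v.
  by rewrite wtD wu wv; lia.
move=> [[u [v [Eu Ev ->]]]]; rewrite wtD => w.
have le_u := wtE Eu; have le_v := wt_ksum_ge Ev.
by exists u, v; split=> //; [split=> //; lia | apply/IHk; split=> //; lia].
Qed.

End LowestWeight.

Hypotheses (ha : (1 <= a)%N) (hb : (1 <= b)%N).

Lemma nu_ge1 u : (1 <= nu a b u)%R = (a * b <= wt u)%N.
Proof.
by rewrite /nu ler_pdivlMr ?mul1r ?ler_nat // ltr0n muln_gt0 ha hb.
Qed.

Lemma nu_eq1 u : (nu a b u = 1)%R <-> wt u = (a * b)%N.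
Proof.
have ab0 : ((a * b)%:R != 0 :> rat)%R by rewrite pnatr_eq0 muln_eq0; lia.
split=> [|e]; last by rewrite /nu -/(wt u) e divff.
move=> /(congr1 (fun q => q * (a * b)%:R)%R); rewrite mul1r /nu divfK //.
by move/eqP; rewrite eqr_nat => /eqP.
Qed.

Lemma wt_le_eq u v : (u <= v)%MM -> (wt v <= wt u)%N -> u = v.
Proof.
move=> le_uv; have /mnm2_lepP[] := le_uv; rewrite /wt => le0 le1 le_wt.
by apply: (mnm_le_anti le_uv); apply/mnm2_lepP; split; nia.
Qed.

End Weight.

(** * Replacing a repeated generator by pure powers *)

Lemma pigeonhole (T : eqType) (box s : seq T) n :
  {subset s <= box} -> (size box * n < size s)%N ->
  exists2 x, x \in s & (n < count_mem x s)%N.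
Proof.
move=> sub lt_s; have [/hasP[x xs lt_x]|/hasPn le_s] :=
  boolP (has (fun x => (n < count_mem x s)%N) s); first by exists x.
suff : (size s <= size box * n)%N by rewrite leqNgt lt_s.
have {le_s}le_s x : (count_mem x s <= n)%N.
  have [xs|/count_memPn -> //] := boolP (x \in s).
  by rewrite leqNgt le_s.
elim: box s sub le_s {lt_s} => [|t box IHbox] s sub le_s.
  by case: s sub {le_s} => [//|x s] /(_ x (mem_head _ _)).
rewrite -(count_predC (pred1 t) s) mulSn leq_add // -size_filter.
apply: IHbox => [x|x].
  by rewrite mem_filter => /andP[/= ne_xt /sub]; rewrite inE (negPf ne_xt).
apply: leq_trans (le_s x); rewrite count_filter.
by apply: sub_count => y /andP[].
Qed.

Lemma split_repeated u n s : (n <= count_mem u s)%N ->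
  exists t, perm_eq s (nseq n u ++ t).
Proof.
move=> le_n; exists (nseq (count_mem u s - n) u ++ filter (predC (pred1 u)) s).
rewrite catA -nseqD subnKC // -size_filter.
rewrite -(all_pred1P _ _ (filter_all (pred1 u) s)).
by rewrite perm_sym; apply/permPl/perm_filterC.
Qed.

Section Reduction.
Variables (a b : nat) (E : set 'X_{1..2}).
Hypotheses (ha : (1 <= a)%N) (hb : (1 <= b)%N).
Hypotheses (Ex : E (xpow a)) (Ey : E (ypow b)).
Hypothesis wtE : forall u, E u -> (a * b <= wt a b u)%N.

(** [u ^ (a * b)] is [x^a] to the power [b * u 0] times [y^b] to the power
    [a * u 1], which involves at least [a * b] factors by the weight bound;
    any [a * b] of them will do. *)
Lemma pure_powers_below u : E u -> exists s,
  [/\ size s = (a * b)%N, forall v, v \in s -> v = xpow a \/ v = ypow b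
    & (msum s <= u *+ (a * b))%MM].
Proof.
move=> /wtE; rewrite /wt => le_u; pose i := minn (b * u 0%R) (a * b).
exists (nseq i (xpow a) ++ nseq (a * b - i) (ypow b)); split.
- by rewrite size_cat !size_nseq /i; lia.
- move=> v; rewrite mem_cat !mem_nseq.
  by case/orP=> /andP[_ /eqP->]; [left|right].
- rewrite msum_cat !msum_nseq; apply/mnm2_lepP.
  rewrite !mnmDE !mulmnE !mnm1E /= !mul0n !mul1n addn0 add0n /i.
  by split; nia.
Qed.

(** A sum of enough exponents from a finite box contains some [u] at least
    [a * b] times, and trading these copies of [u] for pure powers keeps the
    number of summands and makes one of them [x^a] or [y^b].  The box is
    [0 <= u 0 <= a], [0 <= u 1 <= b] because a minimal generator other than
    [x^a] and [y^b] is divisible by neither. *)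
Lemma ksum_reduction :
  (forall u, E u -> u 0%R <= a /\ u 1%R <= b)%N ->
  exists r, forall m, ksum E r.+1 m ->
    exists2 t, addset [set xpow a; ypow b] (ksum E r) t & (t <= m)%MM.
Proof.
move=> Ebox.
pose box := [seq (xpow i + ypow j)%MM | i <- iota 0 a.+1, j <- iota 0 b.+1].
(* One summand more than [a * b - 1] copies of each point of the box. *)
exists (size box * (a * b).-1)%N => _ [s [sz Es ->]].
have sub : {subset s <= box}.
  move=> u /Es/Ebox[le0 le1]; apply/allpairsP; exists (u 0%R, u 1%R).
  rewrite !mem_iota !add0n !ltnS le0 le1; split=> //=.
  by apply: mnm_le_anti; apply/mnm2_lepP; rewrite !mnmDE !xpowE !ypowE;
    rewrite addn0 add0n.
have [|u us lt_u] := pigeonhole sub (n := (a * b).-1); first by rewrite sz.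
have [|t perm_s] := @split_repeated u (a * b) s; first by lia.
have Et v : v \in t -> E v.
  by move=> vt; apply: Es; rewrite (perm_mem perm_s) mem_cat vt orbT.
have [[|v p] [szp Ep le_p]] := pure_powers_below (Es u us).
  by move: szp => /= szp; exfalso; nia.
exists (v + msum (p ++ t))%MM.
  exists v, (msum (p ++ t)); split=> //.
    by case: (Ep v (mem_head _ _)) => ->; [left|right].
  exists (p ++ t); split=> //.
    move: sz szp; rewrite (perm_size perm_s) !size_cat size_nseq /=; lia.
  move=> w; rewrite mem_cat => /orP[wp|/Et//].
  by case: (Ep w); rewrite ?inE ?wp ?orbT // => ->.
have -> : msum s = (u *+ (a * b) + msum t)%MM.
  by rewrite -msum_nseq -msum_cat; apply: perm_big.
have {le_p}: (v + msum p <= u *+ (a * b))%MM.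
  by move: le_p; rewrite /msum big_cons.
rewrite msum_cat addmA => /mnm_lepP le_p; apply/mnm_lepP=> i.
by rewrite [leqRHS]mnmDE mnmDE leq_add2r.
Qed.

End Reduction.
End Exponents.

(** * Monomial ideals through their exponents *)

Section MonomialIdeals.
Variable K : fieldType.
Local Notation mideal := (@mono_ideal K).
Implicit Types (S T : set 'X_{1..2}) (I J L : set {mpoly K[2]}).

Lemma mono_ideal_mem_gen S s : S s -> mideal S 'X_[s].
Proof. by move=> Ss; apply/mono_ideal_mem; exists s; rewrite ?lepm_refl. Qed.

Lemma ideal_mul_mono S T :
  ideal_mul (mideal S) (mideal T) = mideal (addset S T).
Proof.
apply/seteqP; split=> p.
  move=> [n [c [g [fg ->]]]]; apply: ideal_genS => i.
  have [f [h [[n1 [c1 [g1 [S1 ->]]]] [n2 [c2 [g2 [T2 ->]]]] ->]]] := fg i.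
  rewrite mulr_suml.
  under eq_bigr => j _ do rewrite -mulrA.
  apply: ideal_genS => j; rewrite mulr_sumr.
  under eq_bigr => l _ do rewrite mulrCA.
  apply: ideal_genS => l.
  have [s Ss <-] := S1 j; have [t Tt <-] := T2 l.
  by rewrite -mpolyXD; apply: mono_ideal_mem_gen; exists s, t.
move=> [n [c [g [STg ->]]]]; exists n, c, g; split=> // i.
have [_ [s [t [Ss Tt ->]]] <-] := STg i.
by exists 'X_[s]%R, 'X_[t]%R; split; rewrite ?mpolyXD //;
  apply: mono_ideal_mem_gen.
Qed.

Lemma ideal_pow_mono S k : ideal_pow (mideal S) k = mideal (ksum S k).
Proof.
elim: k => [|k IHk] /=; last by rewrite IHk ideal_mul_mono ksumS.
apply/seteqP; split=> // p _.
exists 1%N, (fun=> p), (fun=> 1%R); split; last by rewrite big_ord1 mulr1.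
by move=> _; exists 0%MM; rewrite ?ksum0 // mpolyX0.
Qed.

Lemma mingens_mono_ideal S :
  mingens (mideal S) = [set s | S s /\ forall t, S t -> (t <= s)%MM -> t = s].
Proof. by symmetry; apply/mingens_unique/mono_ideal_mingens. Qed.

Lemma mono_ideal_of_mingens S : mideal (mingens (mideal S)) = mideal S.
Proof.
have monoS : is_mono_ideal (mideal S) by exists S.
by have [<- _] := mingensP monoS.
Qed.

(** * Reduction numbers *)

Lemma reduction_number_spec J L r :
  ideal_pow L r.+1 = ideal_mul J (ideal_pow L r) ->
  is_reduction_number J L (reduction_number J L) /\
  (reduction_number J L <= r)%N.
Proof.
pose P s := `[< ideal_pow L s.+1 = ideal_mul J (ideal_pow L s) >].
move=> red_r; have exP : exists s, P s by exists r; apply/asboolP.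
have redP : is_reduction_number J L (reduction_number J L).
  apply: (xgetPex 0%N); exists (ex_minn exP).
  case: ex_minnP => s /asboolP red_s min_s; split=> // t red_t.
  by apply: min_s; apply/asboolP.
by split=> //; apply: redP.2.
Qed.

(** * Generators of least weight in powers of an ideal of I_{a,b} *)

Section Iab.
Variables (a b : nat) (I : set {mpoly K[2]}).
Hypotheses (ha : (1 <= a)%N) (hb : (1 <= b)%N) (hI : in_Iab a b I).
Local Notation E := (mingens I).
Local Notation E0 := (lowest a b (a * b) E).
Local Notation JE := [set xpow a; ypow b].

Lemma in_Iab_gens : I = mideal E.
Proof. by case: hI => monoI _ _ _; case: (mingensP monoI). Qed.

Lemma pow_gens k : ideal_pow I k = mideal (ksum E k).
Proof. by rewrite [in LHS]in_Iab_gens ideal_pow_mono. Qed.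

Lemma in_Iab_wt u : E u -> (a * b <= wt a b u)%N.
Proof. by case: hI => _ _ _ h /h; rewrite nu_ge1. Qed.

Lemma pow_qe_part_gens k : ideal_pow (qe_part a b I) k = mideal (ksum E0 k).
Proof.
rewrite -ideal_pow_mono; congr (ideal_pow (mono_ideal _) k).
by apply/seteqP; split=> u [Eu] /(nu_eq1 ha hb).
Qed.

Lemma JE_lowest v : JE v -> E0 v.
Proof.
case: hI => _ Ex Ey _ [->|->]; split=> //; [exact: wt_xpow|exact: wt_ypow].
Qed.

Lemma in_Iab_box u : E u -> (u 0%R <= a /\ u 1%R <= b)%N.
Proof.
have minE v : E v -> E u -> (v <= u)%MM -> v = u.
  rewrite in_Iab_gens mingens_mono_ideal => -[Ev _] [_ h]; exact: h.
case: hI => _ Ex Ey _ Eu; split; rewrite leqNgt; apply/negP=> lt_u.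
  suff e : xpow a = u by move: lt_u; rewrite -e xpowE ltnn.
  by apply: minE => //; apply/mnm2_lepP; rewrite !xpowE; lia.
suff e : ypow b = u by move: lt_u; rewrite -e ypowE ltnn.
by apply: minE => //; apply/mnm2_lepP; rewrite !ypowE; lia.
Qed.

Lemma mul_pow_sub_pow F r : JE `<=` F ->
  mideal (addset JE (ksum F r)) `<=` mideal (ksum F r.+1).
Proof.
move=> JF; apply: mono_ideal_sub => m [v [w [/JF Fv Fw ->]]].
by exists (v + w)%MM; rewrite ?lepm_refl // ksumS; exists v, w.
Qed.

Lemma has_reduction :
  exists r, ideal_pow I r.+1 = ideal_mul (Jideal K a b) (ideal_pow I r).
Proof.
have [_ Ex Ey _] := hI.
have [r red_r] := ksum_reduction ha hb Ex Ey in_Iab_wt in_Iab_box.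
exists r; rewrite !pow_gens ideal_mul_mono.
apply/seteqP; split; first exact: mono_ideal_sub.
by apply: mul_pow_sub_pow => v /JE_lowest[].
Qed.

(** By strict monotonicity of [wt], an exponent of [S] properly below [m]
    would have weight less than [c]. *)
Lemma mingens_lowest S c m : (forall t, S t -> (c <= wt a b t)%N) ->
  S m -> wt a b m = c -> mingens (mideal S) m.
Proof.
move=> geS Sm wm; rewrite mingens_mono_ideal; split=> // t St le_tm.
by apply: (wt_le_eq ha hb le_tm); rewrite wm geS.
Qed.

Lemma mingens_qe_part k : (1 <= k)%N ->
  mingens (ideal_pow (qe_part a b I) k) `\`
    mingens (ideal_mul (Jideal K a b) (ideal_pow (qe_part a b I) (k - 1)))
  `<=`
  mingens (ideal_pow I k) `\`
    mingens (ideal_mul (Jideal K a b) (ideal_pow I (k - 1))).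
Proof.
case: k => // k _; rewrite subn1 [k.+1.-1]/= => u [].
rewrite !pow_qe_part_gens !pow_gens !ideal_mul_mono.
rewrite mingens_mono_ideal => -[/(wt_ksum_eq in_Iab_wt)[Eu wu] _] nJu; split.
  by apply: (mingens_lowest _ Eu wu) => t /(wt_ksum_ge in_Iab_wt).
rewrite mingens_mono_ideal => -[[v [w [Jv Ew eq_u]]] _]; apply: nJu.
have wv : wt a b v = (a * b)%N by case: (JE_lowest Jv).
apply: (mingens_lowest _ _ wu).
  move=> _ [v' [w' [/JE_lowest[_ wv'] /(wt_ksum_eq in_Iab_wt)[_ ww'] ->]]].
  by rewrite wtD wv' ww' mulSn.
exists v, w; split=> //; apply/(wt_ksum_eq in_Iab_wt); split=> //.
by move: wu; rewrite eq_u wtD wv mulSn => /addnI.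
Qed.

(** With an empty right-hand side, [mingens_qe_part] says that all generators
    of [I0^(r+1)] are already generators of [J I0^r]. *)
Lemma qe_part_reduction r :
  ideal_pow I r.+1 = ideal_mul (Jideal K a b) (ideal_pow I r) ->
  ideal_pow (qe_part a b I) r.+1 =
    ideal_mul (Jideal K a b) (ideal_pow (qe_part a b I) r).
Proof.
move=> red_r; have := @mingens_qe_part r.+1 isT.
rewrite subn1 red_r setDv !pow_qe_part_gens ideal_mul_mono => sub.
apply/seteqP; split; last exact/mul_pow_sub_pow/JE_lowest.
rewrite -mono_ideal_of_mingens -[X in _ `<=` X]mono_ideal_of_mingens.
apply: mono_ideal_sub => u Gu; exists u; rewrite ?lepm_refl //.
by apply: contrapT => nGu; apply: (sub u).
Qed.

End Iab.
End MonomialIdeals.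

Theorem proposition5p1 (K : fieldType) (a b : nat) (I : set {mpoly K[2]})
  (ha : (1 <= a)%N) (hb : (1 <= b)%N) (hI : in_Iab a b I) :
  let J := Jideal K a b in
  let I0 := qe_part a b I in
  (forall k : nat, (1 <= k)%N ->
     mingens (ideal_pow I0 k) `\` mingens (ideal_mul J (ideal_pow I0 (k - 1)))
     `<=`
     mingens (ideal_pow I k) `\` mingens (ideal_mul J (ideal_pow I (k - 1))))
  /\ (reduction_number J I0 <= reduction_number J I)%N.
Proof.
move=> J I0; split=> [k|]; first exact: mingens_qe_part.
have [r red_r] := has_reduction ha hb hI.
have [[red _] _] := reduction_number_spec red_r.
by have [_] := reduction_number_spec (qe_part_reduction ha hb hI red).
Qed.
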